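(* Let $n_1,\dots,n_M$ be sufficiently smooth molar density fields, let $c_{ij}=c_{ji}$ be constant influence parameters, and let the chemical potentials $\mu_i$ and the pressure $p$ be defined from $\mathbf n=[n_1,\dots,n_M]^T$ by $$\mu_i=\mu_i^b-\sum_{j=1}^M\nabla\cdot(c_{ij}\nabla n_j),\qquad p=p_b-\sum_{i,j=1}^M n_i\nabla\cdot(c_{ij}\nabla n_j)-\frac12\sum_{i,j=1}^M c_{ij}\nabla n_i\cdot\nabla n_j,$$ where $\mu_i^b=\partial f_b(\mathbf n)/\partial n_i$ and $p_b=\sum_{i=1}^M n_i\mu_i^b-f_b(\mathbf n)$. Then the gradients of the pressure and of the chemical potentials satisfy $$\sum_{i=1}^M n_i\nabla\mu_i=\nabla p+\sum_{i,j=1}^M\nabla\cdot\left(c_{ij}\nabla n_i\otimes\nabla n_j\right).$$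
   Context: A fluid mixture of $M$ components is considered at a constant temperature $T$ on a spatial domain $\Omega\subset\mathbb R^d$. $n_i$ is the molar density of component $i$ (a function of space), and $\mathbf n=[n_1,\dots,n_M]^T$. The function $f_b=f_b(\mathbf n)$ (at the fixed $T$) is the bulk Helmholtz free energy density; it is a given smooth function of $\mathbf n$ on its domain of definition, determined by a realistic equation of state (e.g. Peng-Robinson), and $\mathbf n$ takes values in that domain. The total Helmholtz free energy density is $f=f_b(\mathbf n)+\frac12\sum_{i,j=1}^M c_{ij}\nabla n_i\cdot\nabla n_j$. The cross influence parameters $c_{ij}$ are constants (in space and independent of $\mathbf n$) with $c_{ij}=c_{ji}$. With this, $\mu_i$ is the variational derivative of $f$ with respect to $n_i$, and $p_b$ is the bulk pressure. For a tensor field $A=(A_{kl})$, the divergence is the vector field with components $(\nabla\cdot A)_k=\sum_l\partial_l A_{kl}$, and $(\mathbf a\otimes\mathbf b)_{kl}=a_kb_l$. ''Sufficiently smooth'' means that all derivatives appearing exist and are continuous (e.g. $n_i\in C^3$). *)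

(* Defs.v *)
From HB Require Import structures.
From mathcomp Require Import all_boot all_order all_algebra.
From mathcomp Require Import all_classical all_reals all_analysis.

Set Implicit Arguments.
Unset Strict Implicit.
Unset Printing Implicit Defensive.

Import Order.TTheory GRing.Theory Num.Theory.
Import numFieldNormedType.Exports.

Local Open Scope classical_set_scope.
Local Open Scope ring_scope.

Section calculus.
Variables (R : realType) (d : nat).
Implicit Types (f : 'rV[R]_d -> R) (x u v : 'rV[R]_d).

Definition partial (k : 'I_d) f x : R := 'D_(delta_mx 0 k) f x.

(* Meant for an open set [A], where the values of the partial derivatives
   do not depend on those of [f] outside [A]. *)
Fixpoint class_C (r : nat) (A : set 'rV[R]_d) f : Prop :=
  (forall x, A x -> {for x, continuous f}) /\
  (if r is r'.+1 then
     forall k : 'I_d,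
       (forall x, A x -> derivable f x (delta_mx 0 k)) /\
       class_C r' A (partial k f)
   else True).

Definition dotv u v : R := \sum_(k < d) u 0 k * v 0 k.

Definition tensor u v : 'M[R]_d := \matrix_(k, l) (u 0 k * v 0 l).

Definition grad f x : 'rV[R]_d := \row_k partial k f x.

Definition div (F : 'rV[R]_d -> 'rV[R]_d) x : R :=
  \sum_(k < d) partial k (fun y => F y 0 k) x.

Definition tdiv (A : 'rV[R]_d -> 'M[R]_d) x : 'rV[R]_d :=
  \row_k \sum_(l < d) partial l (fun y => A y k l) x.

End calculus.

Section mixture.
Variables (R : realType) (d M : nat).
Variables (fb : 'rV[R]_M -> R) (c : 'M[R]_M) (n : 'I_M -> 'rV[R]_d -> R).
Implicit Types (i : 'I_M) (x : 'rV[R]_d).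

Definition density_vec x : 'rV[R]_M := \row_i n i x.

Definition bulk_chem_pot i x : R := partial i fb (density_vec x).

Definition bulk_pressure x : R :=
  \sum_(i < M) n i x * bulk_chem_pot i x - fb (density_vec x).

Definition chem_pot i x : R :=
  bulk_chem_pot i x - \sum_(j < M) div (fun y => c i j *: grad (n j) y) x.

Definition pressure x : R :=
  bulk_pressure x
  - \sum_(i < M) \sum_(j < M) n i x * div (fun y => c i j *: grad (n j) y) x
  - 2^-1 * \sum_(i < M) \sum_(j < M)
             c i j * dotv (grad (n i) x) (grad (n j) x).

End mixture.

(* Main.v *)
Require Import Defs.
From HB Require Import structures.
From mathcomp Require Import all_boot all_order all_algebra.
From mathcomp Require Import all_classical all_reals all_analysis.
From mathcomp Require Import ring.
Import Order.TTheory GRing.Theory Num.Theory.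
Import numFieldNormedType.Exports.
Local Open Scope classical_set_scope.
Local Open Scope ring_scope.

(** This is the Gibbs-Duhem relation of a fluid with gradient energy.

    The Laplacian terms in the definition of p are those of sum_i n_i mu_i, so
    the pressure has the form of a Legendre transform in the full chemical
    potentials ([pressureE]):
      p = sum_i n_i mu_i - f_b(n) - 1/2 sum_ij c_ij grad n_i . grad n_j.
    Write d_k for the k-th partial derivative and L for the Laplacian, so that
    mu_i = mu_i^b - sum_j c_ij L n_j ([chem_potE]). By the product rule, the
    chain rule d_k f_b(n) = sum_i mu_i^b d_k n_i and d_k d_l n_i = d_l d_k n_i,
      d_k p = sum_i n_i d_k mu_i + sum_i (mu_i - mu_i^b) d_k n_i
              - sum_ij c_ij sum_l (d_l d_k n_i) (d_l n_j),
    where the symmetry of c has turned the two halves of the derivative of the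
    gradient energy into one sum ([half_sum_sym]). The middle term is
    - sum_ij c_ij (d_k n_i) (L n_j), so everything after the first term is
    minus the k-th component of the divergence of the tensors
    c_ij grad n_i (x) grad n_j, which is the claim ([partial_pressure]).

    The analytic input is that mixed second derivatives commute ([schwarz])
    and that a function with continuous partial derivatives is differentiable
    ([is_diff_partial]), which gives the chain rule ([is_derive_chain]). Both
    rest on the mean value theorem along a line ([mvt_line]). The second
    derivatives of f_b and the third derivatives of the n_i enter only through
    the existence of d_k mu_i, which is never expanded. *)

Set Implicit Arguments.
Unset Strict Implicit.

(** * Mean values along lines and mixed derivatives *)

Lemma is_derive_line (R : realType) (V W : normedModType R) (f : V -> W)
    (x v : V) (t : R) :
  derivable f (t *: v + x) v ->
  is_derive t 1 (fun s : R => f (s *: v + x)) ('D_v f (t *: v + x)).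
Proof.
have quotE : (fun h : R => h^-1 *: (f ((h *: 1 + t) *: v + x) - f (t *: v + x)))
    = fun h => h^-1 *: (f (h *: v + (t *: v + x)) - f (t *: v + x)).
  by apply/funext => h; rewrite scalerDl addrA [h *: 1]mulr1.
move=> df; apply: DeriveDef.
  by rewrite /derivable /= quotE; exact: df.
by rewrite /derive /= quotE.
Qed.

Lemma is_derive_translate (R : realType) (V : normedModType R) (f : V -> R)
    (a x v : V) :
  derivable f (a + x) v ->
  is_derive x v (fun y => f (a + y)) ('D_v f (a + x)).
Proof.
have quotE : (fun h : R => h^-1 *: (f (a + (h *: v + x)) - f (a + x)))
    = fun h => h^-1 *: (f (h *: v + (a + x)) - f (a + x)).
  by apply/funext => h; rewrite addrCA.
move=> df; apply: DeriveDef.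
  by rewrite /derivable /= quotE; exact: df.
by rewrite /derive /= quotE.
Qed.

(** The sign of [s] is arbitrary, so the same statement serves increments
    along a coordinate whatever the sign of the displacement. *)
Lemma mvt_line (R : realType) (V : normedModType R) (f : V -> R) (x v : V)
    (s : R) :
  (forall t, `|t| <= `|s| -> derivable f (t *: v + x) v) ->
  exists2 t, `|t| <= `|s| &
    f (s *: v + x) - f x = s * 'D_v f (t *: v + x).
Proof.
move=> df; pose phi (t : R) := f (t *: v + x).
have phi0 : phi 0 = f x by rewrite /phi scale0r add0r.
have itv a b : (forall t, t \in `[a, b] -> `|t| <= `|s|) -> a <= b ->
    exists2 t, `|t| <= `|s| & phi b - phi a = 'D_v f (t *: v + x) * (b - a).
  move=> abs ab.
  have dphi t : t \in `[a, b] -> is_derive t 1 phi ('D_v f (t *: v + x)).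
    by move=> /abs ts; exact/is_derive_line/df.
  have cphi : {within `[a, b], continuous phi}.
    by apply: derivable_within_continuous => t /dphi [].
  have dphio t : t \in `]a, b[ -> is_derive t 1 phi ('D_v f (t *: v + x)).
    by move=> tab; apply: dphi; exact: (subset_itv_oo_cc tab).
  have [t /abs ts phiE] := MVT_segment ab dphio cphi.
  by exists t.
have [s0|s0] := leP 0 s.
  have [|//|t ts] := itv 0 s.
    by move=> t; rewrite in_itv /= => /andP[t0 ts]; rewrite !ger0_norm.
  by rewrite phi0 subr0 mulrC; exists t.
have [|//|t ts] := itv s 0; last 1 first.
- rewrite phi0 sub0r mulrN => /eqP; rewrite -opprB eqr_opp mulrC => /eqP.
  by exists t.
- move=> t; rewrite in_itv /= => /andP[st t0].
  by rewrite !ler0_norm ?lerN2 // ltW.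
- exact: ltW.
Qed.

(** The increment in [s *: v] of [f], seen as a function [phi] of the base
    point, has its mean value along [u] expressed by an increment of ['D_u f]
    in the direction [v]; a second mean value evaluates the latter. *)
Lemma second_difference (R : realType) (V : normedModType R) (f : V -> R)
    (x u v : V) (s : R) :
  (forall t w, `|t| <= `|s| -> `|w| <= `|s| ->
    derivable f (t *: u + (w *: v + x)) u /\
    derivable ('D_u f) (t *: u + (w *: v + x)) v) ->
  exists t w, [/\ `|t| <= `|s|, `|w| <= `|s| &
    f (s *: u + (s *: v + x)) - f (s *: u + x) - f (s *: v + x) + f x
    = s * (s * 'D_v ('D_u f) (t *: u + (w *: v + x)))].
Proof.
move=> df; pose phi y := f (s *: v + y) - f y.
have f1 t : `|t| <= `|s| -> derivable f (t *: u + x) u.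
  by move=> ts; have [] := df t 0; rewrite ?normr0 // scale0r add0r.
have dphi t : `|t| <= `|s| -> is_derive (t *: u + x) u phi
    ('D_u f (s *: v + (t *: u + x)) - 'D_u f (t *: u + x)).
  move=> ts; apply: is_deriveB; last exact/derivableP/f1.
  apply: is_derive_translate; rewrite addrCA.
  by have [] := df t s ts.
have [t ts phiE] : exists2 t, `|t| <= `|s| &
    phi (s *: u + x) - phi x = s * 'D_u phi (t *: u + x).
  by apply: mvt_line => t ts; have [] := dphi t ts.
have [|w ws fE] := @mvt_line R V ('D_u f) (t *: u + x) v s.
  by move=> w ws; rewrite addrCA; have [] := df t w ts ws.
exists t, w; split=> //.
move: phiE; have [_ ->] := dphi t ts; rewrite fE addrCA => <-.
rewrite /phi opprB [s *: v + (_ + _)]addrCA addrA addrAC -!addrA.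
by do 2 congr (_ + _); rewrite addrC.
Qed.

(** The second difference of [f] over a small parallelogram is symmetric in
    [u] and [v]; by [second_difference] it is [s ^+ 2] times a value, at a
    nearby point, of either mixed derivative. So the two mixed derivatives
    take a common value at points arbitrarily close to [x], and continuity
    concludes. *)
Lemma schwarz (R : realType) (V : normedModType R) (f : V -> R) (x u v : V) :
  (\forall y \near x, [/\ derivable f y u, derivable f y v,
      derivable ('D_u f) y v & derivable ('D_v f) y u]) ->
  {for x, continuous ('D_v ('D_u f))} -> {for x, continuous ('D_u ('D_v f))} ->
  'D_v ('D_u f) x = 'D_u ('D_v f) x.
Proof.
move=> df cvu cuv; apply/eqP; rewrite -subr_eq0 -normr_eq0 eq_le.
rewrite normr_ge0 andbT; apply/ler_addgt0Pl => e e0; rewrite addr0.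
have e2 : 0 < e / 2 by rewrite divr_gt0.
have near_close (g : V -> R) : {for x, continuous g} ->
    \forall y \near x, `|g x - g y| < e / 2.
  by move=> /cvgrPdist_lt/(_ _ e2).
have /nbhs_ballP[r /= r0 xr] : \forall y \near x,
    [/\ [/\ derivable f y u, derivable f y v,
      derivable ('D_u f) y v & derivable ('D_v f) y u],
      `|'D_v ('D_u f) x - 'D_v ('D_u f) y| < e / 2 &
      `|'D_u ('D_v f) x - 'D_u ('D_v f) y| < e / 2].
  apply: filterS3 df (near_close _ cvu) (near_close _ cuv) => y dfy vuy uvy.
  exact: (And3 dfy vuy uvy).
(* The parallelogram of side [s] then lies in the ball of radius [r]; the
   summand 1 makes [k] positive when [u] and [v] vanish. *)
pose k := `|u| + `|v| + 1.
have k0 : 0 < k by rewrite ltr_wpDl // addr_ge0.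
pose s := r / (2 * k).
have s0 : 0 < s by rewrite divr_gt0 // mulr_gt0.
have inr t w : `|t| <= `|s| -> `|w| <= `|s| ->
    ball x r (t *: u + (w *: v + x)).
  rewrite (ger0_norm (ltW s0)) => ts ws.
  rewrite -ball_normE /= addrA opprD addrCA subrr addr0 normrN.
  rewrite (le_lt_trans (ler_normD _ _)) // !normrZ.
  have : `|t| * `|u| + `|w| * `|v| <= s * k.
    rewrite /k !mulrDr mulr1 -[leLHS]addr0.
    by apply: lerD (ltW s0); apply: lerD; exact: ler_wpM2r.
  move/le_lt_trans; apply; rewrite /s invfM mulrA divfK ?gt_eqF //.
  by rewrite ltr_pdivrMr // ltr_pMr // ltr1n.
have [t [w [ts ws E1]]] : exists t w, [/\ `|t| <= `|s|, `|w| <= `|s| &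
    f (s *: u + (s *: v + x)) - f (s *: u + x) - f (s *: v + x) + f x
    = s * (s * 'D_v ('D_u f) (t *: u + (w *: v + x)))].
  apply: second_difference => t w ts ws.
  have [[du _ duv _] _ _] := xr _ (inr t w ts ws).
  exact: (conj du duv).
have [w' [t' [ws' ts' E2]]] : exists w t, [/\ `|w| <= `|s|, `|t| <= `|s| &
    f (s *: v + (s *: u + x)) - f (s *: v + x) - f (s *: u + x) + f x
    = s * (s * 'D_u ('D_v f) (w *: v + (t *: u + x)))].
  apply: second_difference => w' t' ws' ts'; rewrite addrCA.
  have [[_ dv _ dvu] _ _] := xr _ (inr t' w' ts' ws').
  exact: (conj dv dvu).
rewrite addrCA [_ - _ - _]addrAC E1 in E2.
have {E1 E2} /esym E := mulfI (lt0r_neq0 s0) (mulfI (lt0r_neq0 s0) E2).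
rewrite addrCA in E.
have [_ A _] := xr _ (inr t w ts ws).
have [_ _ B] := xr _ (inr t' w' ts' ws').
have via := ler_distD ('D_v ('D_u f) (t *: u + (w *: v + x))).
apply: le_trans (via _ _) _.
rewrite [e]splitr; apply: lerD; first exact: ltW A.
rewrite -E distrC; exact: ltW B.
Qed.

(** * Differentiability from continuous partial derivatives *)

Lemma coord_le_norm (R : realType) (m : nat) (h : 'rV[R]_m) (k : 'I_m) :
  `|h 0 k| <= `|h|.
Proof.
rewrite [leRHS]/Num.Def.normr /= mx_normrE.
exact: (le_bigmax _ (fun ij : 'I_1 * 'I_m => `|h ij.1 ij.2|) (0, k)).
Qed.

Lemma norm_le_coord (R : realType) (m : nat) (h : 'rV[R]_m) (b : R) :
  0 <= b -> (forall k, `|h 0 k| <= b) -> `|h| <= b.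
Proof.
move=> b0 hb; rewrite [leLHS]/Num.Def.normr /= mx_normrE.
by apply: bigmax_le => // -[i k] _ /=; rewrite ord1.
Qed.

(** The path from [y] to [h + y] that changes one coordinate at a time stays
    within distance [`|h|] of [y] because the norm is the maximum norm; on
    each leg [mvt_line] applies. *)
Lemma partial_increments (R : realType) (m : nat) (g : 'rV[R]_m -> R)
    (y h : 'rV[R]_m) :
  (forall (k : 'I_m) z, `|z| <= `|h| -> derivable g (z + y) (delta_mx 0 k)) ->
  exists2 z : 'I_m -> 'rV[R]_m, (forall k, `|z k| <= `|h|) &
    g (h + y) - g y = \sum_(k < m) h 0 k * partial k g (z k + y).
Proof.
(* The [j]-th corner of the path, relative to [y]. *)
move=> dg; pose p j : 'rV[R]_m := \row_(k < m) (if (k < j)%N then h 0 k else 0).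
have inh (k : 'I_m) t : `|t| <= `|h 0 k| -> `|t *: delta_mx 0 k + p k| <= `|h|.
  move=> th; apply: norm_le_coord => // l; rewrite !mxE eqxx /=.
  have [->|lk] := eqVneq l k.
    by rewrite mulr1 ltnn addr0 (le_trans th) // coord_le_norm.
  rewrite mulr0 add0r; case: ifP => _; first exact: coord_le_norm.
  by rewrite normr0.
have step (k : 'I_m) : exists2 z : 'rV[R]_m, `|z| <= `|h| &
    g (p k.+1 + y) - g (p k + y) = h 0 k * partial k g (z + y).
  have pS : p k.+1 = h 0 k *: delta_mx 0 k + p k.
    apply/rowP => l; rewrite !mxE eqxx /=.
    have [->|lk] := eqVneq l k; first by rewrite ltnSn ltnn mulr1 addr0.
    by rewrite mulr0 add0r ltnS leq_eqVlt val_eqE (negbTE lk).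
  have [|t th E] := @mvt_line R _ g (p k + y) (delta_mx 0 k) (h 0 k).
    by move=> t th; rewrite addrA; apply/dg/inh.
  exists (t *: delta_mx 0 k + p k); first exact: inh.
  by rewrite pS -!addrA.
have [z zh gz] : exists2 z : 'I_m -> 'rV[R]_m, (forall k, `|z k| <= `|h|) &
    forall k : 'I_m,
      g (p k.+1 + y) - g (p k + y) = h 0 k * partial k g (z k + y).
  by exists (fun k => sval (cid2 (step k))) => k; case: cid2.
exists z => //; under eq_bigr do rewrite -gz.
rewrite -(big_mkord xpredT (fun k => g (p k.+1 + y) - g (p k + y))).
rewrite telescope_sumr //; congr (g _ - g _).
  by congr (_ + y); apply/rowP => k; rewrite mxE ltn_ord.
by rewrite -[LHS]add0r; congr (_ + y); apply/rowP => k; rewrite !mxE.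
Qed.

Section dot_linear.
Variables (R : realType) (m : nat) (a : 'rV[R]_m).

(** [dotv] with its second argument fixed, named so that it can carry a
    linear structure and serve as a differential. *)
Definition dotr (h : 'rV[R]_m) : R := dotv h a.

Fact dotr_is_linear : linear dotr.
Proof.
move=> s u v; rewrite /dotr /dotv scaler_sumr -big_split /=.
by apply: eq_bigr => k _; rewrite !mxE mulrDl -mulrA.
Qed.

HB.instance Definition _ :=
  GRing.isLinear.Build R 'rV[R]_m R _ dotr dotr_is_linear.

Lemma continuous_dotr : continuous dotr.
Proof.
apply: (@continuous_big _ _ _ _ _ add_continuous) => k _ h.
have ch : {for h, continuous (fun h : 'rV[R]_m => h 0 k)}.
  exact: coord_continuous.
have ca : {for h, continuous (fun _ : 'rV[R]_m => a 0 k)}.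
  exact: cst_continuous.
exact: continuousM ch ca.
Qed.

End dot_linear.

Lemma is_diff_linear_approx (R : realType) (V W : normedModType R) (f : V -> W)
    (df : {linear V -> W}) (x : V) :
  continuous df ->
  (forall e : R, 0 < e ->
    \forall h \near (0 : V), `|f (h + x) - f x - df h| <= e * `|h|) ->
  is_diff x f df.
Proof.
move=> cdf approx.
have E : f \o shift x = cst (f x) + df +o_ (0 : V) id.
  apply/eqaddoP => e /approx; apply: filterS => h /=.
  by rewrite [X in _ -> `|X| <= _](_ : _ = f (h + x) - f x - df h) //
    -addrA -opprD.
have dE := diff_unique cdf E.
split; last exact: dE.
by apply/diff_locallyP; rewrite dE.
Qed.

(** By [partial_increments] the error of the linear approximation is a sum of
    [m] terms, each at most [`|h|] times the oscillation of a partial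
    derivative near [y]. *)
Lemma is_diff_partial (R : realType) (m : nat) (g : 'rV[R]_m -> R)
    (y : 'rV[R]_m) :
  (\forall z \near y, forall k : 'I_m, derivable g z (delta_mx 0 k)) ->
  (forall k : 'I_m, {for y, continuous (partial k g)}) ->
  is_diff y g (dotr (grad g y)).
Proof.
move=> dg cg; apply: is_diff_linear_approx; first exact: continuous_dotr.
(* Dividing by [m.+1] rather than [m] also covers the empty sum. *)
move=> e e0; pose e' := e / m.+1%:R.
have e'0 : 0 < e' by rewrite divr_gt0.
have cg' : \forall z \near y, forall k : 'I_m,
    `|partial k g y - partial k g z| < e'.
  apply: (@filter_forall _ _ (fun k z => `|partial k g y - partial k g z| < e')
    _ (nbhs_filter y)) => k.
  by move/cvgrPdist_lt : (cg k) => /(_ _ e'0).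
have /nbhs_ballP[r /= r0 yr] : \forall z \near y,
    (forall k : 'I_m, derivable g z (delta_mx 0 k)) /\
    (forall k : 'I_m, `|partial k g y - partial k g z| < e').
  exact: filterI dg cg'.
apply/nbhs_ballP; exists r => //= h; rewrite -ball_normE /= sub0r normrN => hr.
have inr z : `|z| <= `|h| -> ball y r (z + y).
  rewrite -ball_normE /= opprD addrCA subrr addr0 normrN => zh.
  exact: le_lt_trans zh hr.
have [|z zh ->] := @partial_increments R m g y h.
  by move=> k z /inr /yr [].
rewrite [X in `|X|](_ : _ = \sum_(k < m) h 0 k *
    (partial k g (z k + y) - partial k g y)); last first.
  rewrite /dotr /dotv -sumrB; apply: eq_bigr => k _.
  by rewrite mxE mulrBr.
apply: (le_trans (ler_norm_sum _ _ _)).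
apply: (@le_trans _ _ (\sum_(k < m) `|h| * e')).
  apply: ler_sum => k _; rewrite normrM distrC.
  apply: ler_pM => //; first exact: coord_le_norm.
  by have [_ /(_ k) /ltW] := yr _ (inr _ (zh k)).
rewrite sumr_const card_ord -mulrnAr mulrC ler_wpM2r //.
rewrite /e' -mulr_natr -mulrA ler_piMr ?(ltW e0) //.
by rewrite mulrC ler_pdivrMr // mul1r ler_nat.
Qed.

(** Only the derivative of [gamma] in the direction [v] is at hand, not its
    differential; so [gamma] is replaced by the curve [line], for which
    derivability and differentiability agree, and which has the same
    derivative. *)
Lemma is_derive_chain (R : realType) (V : normedModType R) (m : nat)
    (g : 'rV[R]_m -> R) (gamma : V -> 'rV[R]_m) (x v : V) (dgamma : 'rV[R]_m) :
  (\forall z \near gamma x, forall k : 'I_m, derivable g z (delta_mx 0 k)) ->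
  (forall k : 'I_m, {for gamma x, continuous (partial k g)}) ->
  (forall k, is_derive x v (fun y => gamma y 0 k) (dgamma 0 k)) ->
  is_derive x v (g \o gamma) (dotv dgamma (grad g (gamma x))).
Proof.
move=> dg cg dgam.
pose line (t : R) := gamma (t *: v + x).
have line0 : line 0 = gamma x by rewrite /line scale0r add0r.
have dgamma_x : derivable gamma x v.
  by apply/derivable_mxP => i k; rewrite ord1; case: (dgam k).
have Dgamma : 'D_v gamma x = dgamma.
  rewrite derive_mx //; apply/rowP => k; rewrite mxE.
  by case: (dgam k).
have [dline Dline] : is_derive (0 : R) 1 line dgamma.
  have := @is_derive_line R V _ gamma x v 0.
  rewrite scale0r add0r Dgamma => /(_ dgamma_x) dline; exact: dline.
have difl : differentiable line 0 by exact/derivable1_diffP.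
have [difg Dg] : is_diff (line 0) g (dotr (grad g (gamma x))).
  by rewrite line0; exact: is_diff_partial.
have difgl : differentiable (g \o line) 0 by exact: differentiable_comp.
have dg_gamma : derivable (g \o gamma) x v.
  by apply/derivable1P/derivable1_diffP.
split=> //; have := @is_derive_line R V R (g \o gamma) x v 0.
rewrite scale0r add0r => /(_ dg_gamma) [_ <-].
rewrite -[LHS]/('D_1 (g \o line) 0) deriveE // diff_comp //= Dg.
by rewrite -deriveE // Dline.
Qed.

(** * Derivatives of sums and products *)

Lemma is_derive_bigsum (R : realType) (V : normedModType R) (m : nat)
    (h : 'I_m -> V -> R) (dh : 'I_m -> R) (x v : V) :
  (forall i, is_derive x v (h i) (dh i)) ->
  is_derive x v (fun y => \sum_(i < m) h i y) (\sum_(i < m) dh i).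
Proof.
move=> dhx; rewrite [X in is_derive _ _ X _](_ : _ = \sum_(i < m) h i).
  exact: is_derive_sum.
by apply/funext => y; rewrite fct_sumE.
Qed.

Lemma is_derive_prod (R : realType) (V : normedModType R) (f g : V -> R)
    (x v : V) (df dg : R) :
  is_derive x v f df -> is_derive x v g dg ->
  is_derive x v (fun y => f y * g y) (df * g x + f x * dg).
Proof.
move=> dfx dgx; apply: (is_derive_eq (is_deriveM dfx dgx)).
by rewrite addrC [g x *: _]mulrC.
Qed.

Lemma is_derive_scale (R : realType) (V : normedModType R) (f : V -> R)
    (a : R) (x v : V) (df : R) :
  is_derive x v f df -> is_derive x v (fun y => a * f y) (a * df).
Proof. exact: is_deriveZ. Qed.

(** * Fields with continuous derivatives on an open set *)

Section regularity.
Variables (R : realType) (d : nat) (A : set 'rV[R]_d).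
Implicit Types (f : 'rV[R]_d -> R) (r : nat) (x : 'rV[R]_d) (k l : 'I_d).

Lemma class_CW r f : class_C r.+1 A f -> class_C r A f.
Proof.
elim: r f => [|r IH] f [cf df]; split=> // k.
by have [dfk /IH] := df k.
Qed.

Lemma class_C_cont r f x : class_C r A f -> A x -> {for x, continuous f}.
Proof. by case: r => [|r] [+ _]; exact. Qed.

Lemma class_C_partial r f k : class_C r.+1 A f -> class_C r A (partial k f).
Proof. by move=> [_ /(_ k) []]. Qed.

Lemma class_C_is_derive r f k x : class_C r.+1 A f -> A x ->
  is_derive x (delta_mx 0 k) f (partial k f x).
Proof. by move=> [_ /(_ k) [df _]] /df /derivableP. Qed.

Hypothesis A_open : open A.

Lemma partialC f k l x : class_C 2 A f -> A x ->
  partial l (partial k f) x = partial k (partial l f) x.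
Proof.
move=> f2 Ax; apply: schwarz.
- have : \forall y \near x, A y by exact: open_nbhs_nbhs.
  apply: filterS => y Ay.
  have f1 j := class_C_partial j f2.
  have [dk _] := class_C_is_derive k f2 Ay.
  have [dl _] := class_C_is_derive l f2 Ay.
  have [dkl _] := class_C_is_derive l (f1 k) Ay.
  have [dlk _] := class_C_is_derive k (f1 l) Ay.
  exact: (And4 dk dl dkl dlk).
- exact: (class_C_cont (class_C_partial l (class_C_partial k f2)) Ax).
- exact: (class_C_cont (class_C_partial k (class_C_partial l f2)) Ax).
Qed.

Lemma div_scale_grad f (a : R) x : class_C 2 A f -> A x ->
  div (fun y => a *: grad f y) x =
  a * \sum_(l < d) partial l (partial l f) x.
Proof.
move=> f2 Ax; rewrite /div mulr_sumr; apply: eq_bigr => l _.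
rewrite {1}/partial (_ : (fun y => _) = (fun y => a * partial l f y)); last first.
  by apply/funext => y; rewrite !mxE.
have dfl := class_C_is_derive l (class_C_partial l f2) Ax.
by have [_] := is_derive_scale a dfl.
Qed.

Lemma tdiv_scale_tensor_grad f g (a : R) x k : class_C 2 A f -> class_C 2 A g ->
  A x ->
  tdiv (fun y => a *: tensor (grad f y) (grad g y)) x 0 k =
  a * \sum_(l < d) (partial l (partial k f) x * partial l g x
                    + partial k f x * partial l (partial l g) x).
Proof.
move=> f2 g2 Ax; rewrite mxE mulr_sumr; apply: eq_bigr => l _.
rewrite {1}/partial
  (_ : (fun y => _) = (fun y => a * (partial k f y * partial l g y))); last first.
  by apply/funext => y; rewrite !mxE.
have dfk := class_C_is_derive l (class_C_partial k f2) Ax.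
have dgl := class_C_is_derive l (class_C_partial l g2) Ax.
by have [_] := is_derive_scale a (is_derive_prod dfk dgl).
Qed.

(** [partialC] is applied here so that the derivative along [k] comes first
    in the second derivatives, the form in which they occur in
    [tdiv_scale_tensor_grad]. *)
Lemma is_derive_dot_grad f g x k : class_C 2 A f -> class_C 2 A g -> A x ->
  is_derive x (delta_mx 0 k) (fun y => dotv (grad f y) (grad g y))
    (\sum_(l < d) partial l (partial k f) x * partial l g x
     + \sum_(l < d) partial l (partial k g) x * partial l f x).
Proof.
move=> f2 g2 Ax; rewrite -big_split /= /dotv; apply: is_derive_bigsum => l.
rewrite (_ : (fun y => _) = (fun y => partial l f y * partial l g y)); last first.
  by apply/funext => y; rewrite !mxE.
have dfl := class_C_is_derive k (class_C_partial l f2) Ax.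
have dgl := class_C_is_derive k (class_C_partial l g2) Ax.
apply: (is_derive_eq (is_derive_prod dfl dgl)).
by rewrite !(partialC _ k) // [X in _ + X]mulrC.
Qed.

End regularity.

(** * Chemical potentials and pressure *)

Lemma half_sum_sym (R : realType) (m : nat) (c a : 'I_m -> 'I_m -> R) :
  (forall i j, c i j = c j i) ->
  2^-1 * \sum_(i < m) \sum_(j < m) c i j * (a i j + a j i)
  = \sum_(i < m) \sum_(j < m) c i j * a i j.
Proof.
move=> c_sym.
have swap : \sum_(i < m) \sum_(j < m) c i j * a j i
          = \sum_(i < m) \sum_(j < m) c i j * a i j.
  rewrite exchange_big /=; apply: eq_bigr => i _; apply: eq_bigr => j _.
  by rewrite c_sym.
under eq_bigr do under eq_bigr do rewrite mulrDr.
under eq_bigr do rewrite big_split.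
by rewrite big_split /= swap; field.
Qed.

Section mixture.
Variables (R : realType) (d M : nat).
Variables (Omega : set 'rV[R]_d) (D : set 'rV[R]_M).
Variables (fb : 'rV[R]_M -> R) (c : 'M[R]_M) (n : 'I_M -> 'rV[R]_d -> R).
Hypotheses (Omega_open : open Omega) (D_open : open D).
Hypothesis fb_smooth : class_C 2 D fb.
Hypothesis n_smooth : forall i : 'I_M, class_C 3 Omega (n i).
Hypothesis n_in_D : forall x, Omega x -> D (density_vec n x).

Let n_C2 i : class_C 2 Omega (n i) := class_CW (n_smooth i).

Lemma is_derive_density_comp (g : 'rV[R]_M -> R) x (k : 'I_d) :
  class_C 1 D g -> Omega x ->
  is_derive x (delta_mx 0 k) (fun y => g (density_vec n y))
    (\sum_(i < M) partial k (n i) x * partial i g (density_vec n x)).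
Proof.
move=> g1 Ox; have Dx := n_in_D Ox.
have dg : \forall z \near density_vec n x,
    forall i : 'I_M, derivable g z (delta_mx 0 i).
  have : \forall z \near density_vec n x, D z by exact: open_nbhs_nbhs.
  by apply: filterS => z Dz i; have [] := class_C_is_derive i g1 Dz.
have cg i : {for density_vec n x, continuous (partial i g)}.
  exact: class_C_cont (class_C_partial i g1) Dx.
pose dn : 'rV[R]_M := \row_i partial k (n i) x.
have dnx i :
    is_derive x (delta_mx 0 k) (fun y => density_vec n y 0 i) (dn 0 i).
  rewrite mxE (_ : (fun y => _) = n i); last by apply/funext => y; rewrite mxE.
  exact: class_C_is_derive (n_smooth i) Ox.
apply: (is_derive_eq (is_derive_chain dg cg dnx)).
by rewrite /dotv; apply: eq_bigr => i _; rewrite !mxE.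
Qed.

Lemma chem_potE i x : Omega x ->
  chem_pot fb c n i x = bulk_chem_pot fb n i x
    - \sum_(j < M) c i j * \sum_(l < d) partial l (partial l (n j)) x.
Proof.
move=> Ox; rewrite /chem_pot; congr (_ - _); apply: eq_bigr => j _.
exact: (div_scale_grad _ (n_C2 j)).
Qed.

(** The formula of [chem_potE] holds only on [Omega], hence the passage
    through a function equal to the chemical potential near [x]. The value of
    the derivative is left unexpanded because the terms
    [n i x * partial k (chem_pot fb c n i) x] occur on both sides of the
    final identity. *)
Lemma is_derive_chem_pot i x (k : 'I_d) : Omega x ->
  is_derive x (delta_mx 0 k) (chem_pot fb c n i)
    (partial k (chem_pot fb c n i) x).
Proof.
move=> Ox; apply/derivableP.
have nearE : {near x, (fun y => bulk_chem_pot fb n i y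
    - \sum_(j < M) c i j * \sum_(l < d) partial l (partial l (n j)) y)
    =1 chem_pot fb c n i}.
  have : \forall y \near x, Omega y by exact: open_nbhs_nbhs.
  by apply: filterS => y Oy; rewrite chem_potE.
apply: (near_eq_derivable nearE).
have [db _] := is_derive_density_comp k (class_C_partial i fb_smooth) Ox.
have [dl _] : is_derive x (delta_mx 0 k)
    (fun y => \sum_(j < M) c i j * \sum_(l < d) partial l (partial l (n j)) y)
    (\sum_(j < M) c i j *
       \sum_(l < d) partial k (partial l (partial l (n j))) x).
  apply: is_derive_bigsum => j; apply: is_derive_scale.
  apply: is_derive_bigsum => l; apply: class_C_is_derive Ox.
  exact: class_C_partial (class_C_partial l (n_smooth j)).
exact: derivableB db dl.
Qed.

(** The Laplacian terms of the pressure are exactly those that complete each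
    bulk chemical potential to the full one. *)
Lemma pressureE x :
  pressure fb c n x =
    \sum_(i < M) n i x * chem_pot fb c n i x - fb (density_vec n x)
    - 2^-1 * \sum_(i < M) \sum_(j < M)
               c i j * dotv (grad (n i) x) (grad (n j) x).
Proof.
rewrite /pressure /bulk_pressure; congr (_ - _); rewrite addrAC -sumrB.
congr (_ - _); apply: eq_bigr => i _.
by rewrite /chem_pot mulrBr mulr_sumr.
Qed.

Lemma is_derive_pressure x (k : 'I_d) : Omega x ->
  is_derive x (delta_mx 0 k) (pressure fb c n)
    (\sum_(i < M) (partial k (n i) x * chem_pot fb c n i x
                   + n i x * partial k (chem_pot fb c n i) x)
     - \sum_(i < M) partial k (n i) x * bulk_chem_pot fb n i x
     - 2^-1 * \sum_(i < M) \sum_(j < M) c i j *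
         (\sum_(l < d) partial l (partial k (n i)) x * partial l (n j) x
          + \sum_(l < d) partial l (partial k (n j)) x * partial l (n i) x)).
Proof.
move=> Ox; rewrite (funext pressureE).
apply: is_deriveB; first apply: is_deriveB.
- apply: is_derive_bigsum => i; apply: is_derive_prod.
    exact: class_C_is_derive (n_smooth i) Ox.
  exact: is_derive_chem_pot.
- exact: is_derive_density_comp (class_CW fb_smooth) Ox.
apply: is_derive_scale; apply: is_derive_bigsum => i.
apply: is_derive_bigsum => j; apply: is_derive_scale.
exact: (is_derive_dot_grad Omega_open k (n_C2 i) (n_C2 j) Ox).
Qed.

Hypothesis c_sym : forall i j : 'I_M, c i j = c j i.

Lemma partial_pressure x (k : 'I_d) : Omega x ->
  \sum_(i < M) n i x * partial k (chem_pot fb c n i) x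
  = partial k (pressure fb c n) x
    + \sum_(i < M) \sum_(j < M) c i j * \sum_(l < d)
        (partial l (partial k (n i)) x * partial l (n j) x
         + partial k (n i) x * partial l (partial l (n j)) x).
Proof.
move=> Ox; have [_ dp] := is_derive_pressure k Ox.
rewrite [partial k (pressure _ _ _) x]dp {dp}.
rewrite (half_sum_sym (fun i j =>
  \sum_(l < d) partial l (partial k (n i)) x * partial l (n j) x) c_sym).
(* [S] is the part of the tensor divergence that cancels the derivative of
   the gradient energy; the other part has the Laplacians. *)
set S := \sum_(i < M) \sum_(j < M) c i j * _.
have -> : \sum_(i < M) \sum_(j < M) c i j * \sum_(l < d)
      (partial l (partial k (n i)) x * partial l (n j) x
       + partial k (n i) x * partial l (partial l (n j)) x)
    = S + \sum_(i < M) partial k (n i) x *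
            \sum_(j < M) c i j * \sum_(l < d) partial l (partial l (n j)) x.
  rewrite -big_split /=; apply: eq_bigr => i _.
  rewrite mulr_sumr -big_split /=; apply: eq_bigr => j _.
  by rewrite big_split /= mulrDr -mulr_sumr mulrCA.
have -> : \sum_(i < M) partial k (n i) x *
      \sum_(j < M) c i j * \sum_(l < d) partial l (partial l (n j)) x
    = \sum_(i < M) partial k (n i) x * bulk_chem_pot fb n i x
      - \sum_(i < M) partial k (n i) x * chem_pot fb c n i x.
  rewrite -sumrB; apply: eq_bigr => i _; rewrite chem_potE //; ring.
by rewrite big_split /=; ring.
Qed.

End mixture.

Unset Implicit Arguments.

Theorem theorem4p1 (R : realType) (d M : nat)
  (Omega : set 'rV[R]_d) (D : set 'rV[R]_M)
  (fb : 'rV[R]_M -> R) (c : 'M[R]_M) (n : 'I_M -> 'rV[R]_d -> R)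
  (Omega_open : open Omega) (D_open : open D)
  (fb_smooth : class_C 2 D fb)
  (c_sym : forall i j : 'I_M, c i j = c j i)
  (n_smooth : forall i : 'I_M, class_C 3 Omega (n i))
  (n_in_D : forall x, Omega x -> D (density_vec n x)) :
  forall x, Omega x ->
    \sum_(i < M) n i x *: grad (chem_pot fb c n i) x =
    grad (pressure fb c n) x
    + \sum_(i < M) \sum_(j < M)
        tdiv (fun y => c i j *: tensor (grad (n i) y) (grad (n j) y)) x.
Proof.
move=> x Ox; apply/rowP => k.
rewrite summxE [RHS]mxE [in RHS]mxE summxE.
under eq_bigr do rewrite !mxE.
rewrite (partial_pressure Omega_open D_open fb_smooth n_smooth n_in_D c_sym) //.
congr (_ + _); apply: eq_bigr => i _; rewrite summxE; apply: eq_bigr => j _.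
by rewrite (tdiv_scale_tensor_grad _ _ (class_CW (n_smooth i))
  (class_CW (n_smooth j))).
Qed.
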